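(* Let $(X,X_0)$ and $(Y,Y_0)$ be Hausdorff space pairs and let $G$ be an abelian coefficient group. If $\mathrm{Sh}_{\mathrm{CH}}(X,X_0)=\mathrm{Sh}_{\mathrm{CH}}(Y,Y_0)$, then the relative singular homology groups satisfy $H_n(X,X_0;G)\cong H_n(Y,Y_0;G)$ for each $n\in\mathbb N$.
   Context: $\mathbb N=\{0,1,2,\dots\}$. Maps are continuous. A Hausdorff space pair $(X,X_0)$ is a Hausdorff space $X$ with a subset $X_0\subset X$; it is compact if both $X$ and $X_0$ are compact. A map of pairs $f:(X,X_0)\to(Y,Y_0)$ is a map $f:X\to Y$ with $f(X_0)\subset Y_0$; homotopies of maps of pairs are required to send $X_0$ into $Y_0$ at all times. HCpt$^2$ is the category whose objects are compact Hausdorff space pairs and whose morphisms are homotopy classes $[\varphi]$ of maps of pairs. Direct systems. A directed set is a preordered set in which any two elements have an upper bound. A direct system in a category $\mathscr C$ is $X^*=\{X_a,p_{aa'},A\}$ with $A$ a directed set, objects $X_a$ ($a\in A$), and morphisms $p_{aa'}:X_a\to X_{a'}$ for $a\le a'$, with $p_{aa}=1_{X_a}$ and $X_a\to X_{a'}\to X_{a''}$ composing to $p_{aa''}$ for $a\le a'\le a''$. A morphism $F=(f_a,f):X^*\to Y^*=\{Y_b,q_{bb'},B\}$ consists of an order-preserving function $f:A\to B$ and morphisms $f_a:X_a\to Y_{f(a)}$ with $q_{f(a)f(a')}\circ f_a=f_{a'}\circ p_{aa'}$ for $a\le a'$. Composition is $(g_b,g)\circ(f_a,f)=(g_{f(a)}\circ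 f_a,\,g\circ f)$, and $1_{X^*}=(1_{X_a},1_A)$. Two morphisms $(f_a,f),(g_a,g):X^*\to Y^*$ are equivalent, written $\simeq$, if for each $a\in A$ there is $b\in B$ with $f(a)\le b$, $g(a)\le b$ and $q_{f(a)b}\circ f_a=q_{g(a)b}\circ g_a$. CH-shape of pairs. For a Hausdorff space pair $(X,X_0)$ let $c(X,X_0)$ be the set of pairs $(K,K_0)$ with $K,K_0$ compact, $K_0\subset K\subset X$, $K_0\subset X_0$, ordered by $(K,K_0)\le(K',K_0')$ iff $K\subset K'$ and $K_0\subset K_0'$. Let $C(X,X_0)$ be the direct system in HCpt$^2$ indexed by $c(X,X_0)$, with objects $(K,K_0)$ and morphisms the homotopy classes of the inclusions. $\mathrm{Sh}_{\mathrm{CH}}(X,X_0)=\mathrm{Sh}_{\mathrm{CH}}(Y,Y_0)$ means there are morphisms of direct systems in HCpt$^2$ $F:C(X,X_0)\to C(Y,Y_0)$ and $G:C(Y,Y_0)\to C(X,X_0)$ with $GF\simeq 1_{C(X,X_0)}$ and $FG\simeq 1_{C(Y,Y_0)}$. *)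

(* Defs.v *)
Set Warnings "-notation-overridden,-ambiguous-paths,-notation-incompatible-prefix".
From HB Require Import structures.
From mathcomp Require Import all_boot all_order all_algebra.
From mathcomp Require Import generic_quotient ring_quotient finmap.
From mathcomp Require Import all_classical all_reals topology normedtype.
(* The notations of monalg clash with those of mathcomp-analysis. *)
From mathcomp Require Import -(notations) monalg.
From mathcomp Require Import zify lra ring.

Set Implicit Arguments.
Unset Strict Implicit.
Unset Printing Implicit Defensive.

Import Order.TTheory GRing.Theory Num.Theory.
Import numFieldNormedType.Exports.
Import Quotient.

Local Open Scope classical_set_scope.
Local Open Scope ring_scope.
Local Open Scope quotient_scope.

Lemma comp_continuous (X Y Z : topologicalType) (g : Y -> Z) (f : X -> Y) :
  continuous g -> continuous f -> continuous (fun x => g (f x)).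
Proof.
by move=> cg cf x; apply: (@continuous_comp _ _ _ f g); [exact: cf|exact: cg].
Qed.

Lemma pair_continuous (X Y Z : topologicalType) (f : X -> Y) (g : X -> Z) :
  continuous f -> continuous g -> continuous (fun x => (f x, g x)).
Proof. by move=> cf cg x; apply: cvg_pair; [exact: cf|exact: cg]. Qed.

Lemma set_val_continuous (X : topologicalType) (A : set X) :
  continuous (@set_val X A).
Proof. exact: initial_continuous. Qed.

Lemma fst_continuous (X Y : topologicalType) : continuous (@fst X Y).
Proof. by move=> x; exact: cvg_fst. Qed.

Lemma snd_continuous (X Y : topologicalType) : continuous (@snd X Y).
Proof. by move=> x; exact: cvg_snd. Qed.

Record hausdorffPair := HausdorffPair {
  hp_space :> topologicalType;
  hp_sub : set hp_space;
  hp_hausdorff : hausdorff_space hp_space }.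
Arguments hp_sub : clear implicits.

Record compactPair := CompactPair {
  cp_pair :> hausdorffPair;
  cp_compact : compact [set: hp_space cp_pair];
  cp_compact_sub : compact (hp_sub cp_pair) }.

Record pairMap (P Q : hausdorffPair) := PairMap {
  pm_fun :> P -> Q;
  pm_continuous : continuous pm_fun;
  pm_sub : forall x, hp_sub P x -> hp_sub Q (pm_fun x) }.

Arguments pm_continuous {P Q} p.
Arguments pm_sub {P Q} p [x] _.

HB.instance Definition _ P Q := gen_eqMixin (pairMap P Q).
HB.instance Definition _ P Q := gen_choiceMixin (pairMap P Q).

Lemma pairMapP P Q (f g : pairMap P Q) : f =1 g -> f = g.
Proof.
case: f g => [f fc fs] [g gc gs] /= /funext fg.
rewrite fg in fc fs *.
by rewrite (Prop_irrelevance fc gc) (Prop_irrelevance fs gs).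
Qed.

Definition pm_id P : pairMap P P :=
  @PairMap P P idfun (fun x => cvg_id) (fun x h => h).

Lemma pm_comp_continuous P Q S (g : pairMap Q S) (f : pairMap P Q) :
  continuous (g \o f).
Proof. by apply: comp_continuous; exact: pm_continuous. Qed.

Definition pm_comp P Q S (g : pairMap Q S) (f : pairMap P Q) : pairMap P S :=
  @PairMap P S (g \o f) (@pm_comp_continuous _ _ _ g f)
    (fun x h => pm_sub g (pm_sub f h)).

Section UnitInterval.
Variable R : realType.

Definition unitInterval : topologicalType := set_type `[0 : R, 1]%classic.

(* clamp is the retraction of R onto [0, 1]; it serves to name points of the
   interval and to reparameterize homotopies. *)
Lemma clamp_subproof (t : R) :
  Num.max 0 (Num.min 1 t) \in `[0 : R, 1]%classic.
Proof.
by rewrite inE/= in_itv/= le_max lexx/= ge_max ler01 ge_min lexx.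
Qed.

Definition clamp (t : R) : unitInterval :=
  @exist R (fun x => x \in `[0 : R, 1]%classic) _ (clamp_subproof t).

Definition I0 : unitInterval := clamp 0.
Definition I1 : unitInterval := clamp 1.

Lemma clampE (t : R) : 0 <= t <= 1 -> set_val (clamp t) = t.
Proof. by move=> /andP[t0 t1]; rewrite set_valE/= min_r// max_r. Qed.

Lemma clampK (t : unitInterval) : clamp (set_val t) = t.
Proof.
case: t => t tI; apply: val_inj; rewrite set_valE /=.
by have /set_mem := tI; rewrite /= in_itv/= => /andP[t0 t1]; rewrite min_r// max_r.
Qed.

Lemma clamp_continuous : continuous clamp.
Proof.
apply: continuous_comp_initial.
rewrite (_ : _ \o _ = (cst 0 \max (cst 1 \min (@idfun R)))) //.
apply: max_fun_continuous; first exact: cst_continuous.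
apply: min_fun_continuous; first exact: cst_continuous.
by move=> x; exact: cvg_id.
Qed.

End UnitInterval.
Arguments unitInterval : clear implicits.
Arguments I0 : clear implicits.
Arguments I1 : clear implicits.

Section Homotopy.
Variable R : realType.
Local Notation I := (unitInterval R).

Section Relation.
Variables P Q : hausdorffPair.

Definition homotopic_prop (f g : pairMap P Q) : Prop :=
  exists H : P * I -> Q,
    [/\ continuous H,
        forall x, H (x, I0 R) = f x,
        forall x, H (x, I1 R) = g x &
        forall x t, hp_sub P x -> hp_sub Q (H (x, t))].

Definition homotopic (f g : pairMap P Q) : bool := `[< homotopic_prop f g >].

Lemma homotopic_refl : reflexive homotopic.
Proof.
move=> f; apply/asboolP; exists (f \o fst); split=> //.
- by apply: comp_continuous; [exact: pm_continuous|exact: fst_continuous].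
- by move=> x t; exact: pm_sub.
Qed.

Lemma homotopic_symP f g : homotopic f g -> homotopic g f.
Proof.
move=> /asboolP[H [cH H0 H1 HS]]; apply/asboolP.
exists (fun xt : P * I => H (xt.1, clamp (1 - set_val xt.2))); split.
- apply: comp_continuous => //.
  apply: pair_continuous; first exact: fst_continuous.
  apply: (comp_continuous (@clamp_continuous R)) => xt.
  apply: cvgB; first exact: cvg_cst.
  apply: (comp_continuous (@set_val_continuous _ _)).
  exact: snd_continuous.
- by move=> x /=; rewrite clampE ?lexx ?ler01// subr0 H1.
- by move=> x /=; rewrite clampE ?lexx ?ler01// subrr H0.
- by move=> x t; exact: HS.
Qed.

Lemma homotopic_sym : symmetric homotopic.
Proof. by move=> f g; apply/idP/idP; exact: homotopic_symP. Qed.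

Lemma homotopic_trans : transitive homotopic.
Proof.
move=> g f h /asboolP[H [cH H0 H1 HS]] /asboolP[K [cK K0 K1 KS]].
pose tm (xt : P * I) : R := set_val xt.2.
have ctm : continuous tm.
  by apply: comp_continuous; [exact: set_val_continuous|exact: snd_continuous].
pose H' (xt : P * I) := H (xt.1, clamp (2 * tm xt)).
pose K' (xt : P * I) := K (xt.1, clamp (2 * tm xt - 1)).
have cH' : continuous H'.
  apply: comp_continuous => //.
  apply: pair_continuous; first exact: fst_continuous.
  apply: (comp_continuous (@clamp_continuous R)) => xt.
  by apply: cvgM; [exact: cvg_cst|exact: ctm].
have cK' : continuous K'.
  apply: comp_continuous => //.
  apply: pair_continuous; first exact: fst_continuous.
  apply: (comp_continuous (@clamp_continuous R)) => xt.
  apply: cvgB; last exact: cvg_cst.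
  by apply: cvgM; [exact: cvg_cst|exact: ctm].
pose A : set (P * I) := tm @^-1` [set r | r <= 2^-1].
pose B : set (P * I) := tm @^-1` [set r | 2^-1 <= r].
have cA : closed A by apply: preimage_closed => //; exact: closed_le.
have cB : closed B by apply: preimage_closed => //; exact: closed_ge.
have AB : A `|` B = setT.
  rewrite -subTset => xt _; rewrite /A /B /=.
  by have /orP[] := le_total (tm xt) 2^-1; [left|right].
pose L xt := if tm xt <= 2^-1 then H' xt else K' xt.
apply/asboolP; exists L; split.
- apply/continuous_subspace_setT; rewrite -AB.
  apply: withinU_continuous => //.
  + apply: (@subspace_eq_continuous _ A _ H' L).
      by move=> xt /set_mem Axt; rewrite /L ifT.
    exact: continuous_subspaceT.
  + apply: (@subspace_eq_continuous _ B _ K' L).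
      move=> xt /set_mem Bxt; rewrite /L; case: ifPn => // Axt.
      have tE : tm xt = 2^-1 by apply: le_anti; rewrite Axt; exact: Bxt.
      rewrite /H' /K' tE mulfV ?pnatr_eq0// subrr.
      by rewrite -/(I1 R) -/(I0 R) H1 K0.
    exact: continuous_subspaceT.
- move=> x; have t0 : tm (x, I0 R) = 0 by rewrite /tm clampE// lexx ler01.
  by rewrite /L t0 invr_ge0 ler0n /H' t0 mulr0 H0.
- move=> x; have t1 : tm (x, I1 R) = 1 by rewrite /tm clampE// lexx ler01.
  rewrite /L t1 /K' t1 ifF; last by apply/negbTE; rewrite -ltNge; lra.
  by rewrite mulr1 (_ : 2 - 1 = 1 :> R) ?K1//; lra.
- by move=> x t Px; rewrite /L; case: ifP => _; [exact: HS|exact: KS].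
Qed.

Canonical homotopic_equiv :=
  EquivRel homotopic homotopic_refl homotopic_sym homotopic_trans.

Definition homotopyClass := {eq_quot homotopic}.

End Relation.

Lemma homotopic_comp P Q S (f f' : pairMap P Q) (g g' : pairMap Q S) :
  homotopic f f' -> homotopic g g' -> homotopic (pm_comp g f) (pm_comp g' f').
Proof.
move=> /asboolP[H [cH H0 H1 HS]] /asboolP[K [cK K0 K1 KS]]; apply/asboolP.
exists (fun xt => K (H xt, xt.2)); split.
- apply: comp_continuous => //.
  by apply: pair_continuous => //; exact: snd_continuous.
- by move=> x /=; rewrite H0 K0.
- by move=> x /=; rewrite H1 K1.
- by move=> x t /(HS _ t); exact: KS.
Qed.

End Homotopy.

Record category := Category {
  obj :> Type;
  hom : obj -> obj -> Type;
  idm : forall a, hom a a;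
  compm : forall a b c, hom b c -> hom a b -> hom a c;
  compmA : forall a b c d (h : hom c d) (g : hom b c) (f : hom a b),
    compm h (compm g f) = compm (compm h g) f;
  comp1m : forall a b (f : hom a b), compm (idm b) f = f;
  compm1 : forall a b (f : hom a b), compm f (idm a) = f }.
Arguments idm {c} a : rename.
Arguments compm {c0 a b c} _ _ : rename.

Record directSystem (C : category) := DirectSystem {
  ds_disp : Order.disp_t;
  ds_index : preorderType ds_disp;
  ds_directed : forall a b : ds_index, exists c, (a <= c)%O /\ (b <= c)%O;
  ds_obj : ds_index -> C;
  ds_map : forall a b, (a <= b)%O -> hom (ds_obj a) (ds_obj b);
  ds_map_id : forall a (aa : (a <= a)%O), ds_map aa = idm (ds_obj a);
  ds_map_comp : forall a b c (ab : (a <= b)%O) (bc : (b <= c)%O)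
    (ac : (a <= c)%O), compm (ds_map bc) (ds_map ab) = ds_map ac }.
Arguments ds_obj {C} d _.
Arguments ds_map {C} d {a b} _.

Section DirectSystemMorphisms.
Variable C : category.

Record dsMorphism (X Y : directSystem C) := DsMorphism {
  dm_index : ds_index X -> ds_index Y;
  dm_homo : {homo dm_index : a b / (a <= b)%O};
  dm_map : forall a, hom (ds_obj X a) (ds_obj Y (dm_index a));
  dm_natural : forall a b (ab : (a <= b)%O),
    compm (ds_map Y (dm_homo ab)) (dm_map a) =
    compm (dm_map b) (ds_map X ab) }.
Arguments dm_index {X Y} d _.
Arguments dm_map {X Y} d a.
Arguments dm_homo {X Y} d [x y] _.

Definition dm_id X : dsMorphism X X.
Proof.
refine (@DsMorphism X X id (fun a b ab => ab) (fun a => idm _) _).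
by move=> a b ab; rewrite comp1m compm1.
Defined.

Definition dm_comp X Y Z (G : dsMorphism Y Z) (F : dsMorphism X Y) :
  dsMorphism X Z.
Proof.
refine (@DsMorphism X Z (dm_index G \o dm_index F)
  (fun a b ab => dm_homo G (dm_homo F ab))
  (fun a => compm (dm_map G (dm_index F a)) (dm_map F a)) _).
by move=> a b ab; rewrite compmA dm_natural -!compmA dm_natural.
Defined.

Definition dm_equiv X Y (F G : dsMorphism X Y) : Prop :=
  forall a, exists b (Fb : (dm_index F a <= b)%O) (Gb : (dm_index G a <= b)%O),
    compm (ds_map Y Fb) (dm_map F a) = compm (ds_map Y Gb) (dm_map G a).

End DirectSystemMorphisms.
Arguments dm_index {C X Y} d _.
Arguments dm_map {C X Y} d a.
Arguments dm_homo {C X Y} d [x y] _.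

Section HCpt2.
Variable R : realType.

Definition hclass (P Q : hausdorffPair) (f : pairMap P Q) :
  homotopyClass R P Q := \pi_(homotopyClass R P Q) f.

(* Defined on representatives; independence of the choice is hclass_compE. *)
Definition hclass_comp (P Q S : hausdorffPair)
    (g : homotopyClass R Q S) (f : homotopyClass R P Q) :
  homotopyClass R P S := hclass (pm_comp (repr g) (repr f)).

Lemma hclassP P Q (f g : pairMap P Q) : hclass f = hclass g <-> homotopic R f g.
Proof. by split=> [/eqP|fg]; [|apply/eqP]; rewrite eqmodE. Qed.

Lemma hclass_compE P Q S (g : pairMap Q S) (f : pairMap P Q) :
  hclass_comp (hclass g) (hclass f) = hclass (pm_comp g f).
Proof.
by apply/hclassP; apply: homotopic_comp; apply/hclassP; rewrite /hclass reprK.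
Qed.

Definition HCpt2 : category.
Proof.
refine (@Category compactPair (fun P Q => homotopyClass R P Q)
  (fun P => hclass (pm_id P))
  (fun P Q S => @hclass_comp P Q S) _ _ _).
- move=> P Q S T h g f.
  rewrite -[h]reprK -[g]reprK -[f]reprK -!/(hclass _) !hclass_compE.
  by congr hclass; exact: pairMapP.
- move=> P Q f; rewrite -[f]reprK -!/(hclass _) hclass_compE.
  by congr hclass; exact: pairMapP.
- move=> P Q f; rewrite -[f]reprK -!/(hclass _) hclass_compE.
  by congr hclass; exact: pairMapP.
Defined.

End HCpt2.

Lemma compact_set_type (X : topologicalType) (A : set X) (B : set (set_type A)) :
  compact (set_val @` B) -> compact B.
Proof.
move=> cB F PF FB.
have [|p [[x Bx <-] xF]] := cB (set_val @ F) _.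
  by rewrite nbhs_simpl /=; apply: filterS FB => x Bx; exists x.
exists x; split=> // U V FU [_ [[W oW <-] Wx WV]].
have [||y [[z Uz <-] Wz]] := xF (set_val @` U) W.
- by rewrite nbhs_simpl /=; apply: filterS FU => z Uz; exists z.
- exact: open_nbhs_nbhs.
by exists z; split=> //; exact: WV.
Qed.

Lemma hausdorff_set_type (X : topologicalType) (A : set X) :
  hausdorff_space X -> hausdorff_space (set_type A).
Proof.
move=> hX p q pq; apply: val_inj; rewrite -!set_valE; apply: hX => U V Up Vq.
have [||z [Uz Vz]] := pq (set_val @^-1` U) (set_val @^-1` V).
- exact: set_val_continuous Up.
- exact: set_val_continuous Vq.
by exists (set_val z).
Qed.

Section CompactSubpairs.
Variable X : hausdorffPair.

(* The set c(X, X0), where X0 is hp_sub X. *)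
Record compactSubpair := CompactSubpair {
  cs_set : set X;
  cs_sub : set X;
  cs_compact : compact cs_set;
  cs_compact_sub : compact cs_sub;
  cs_sub_set : cs_sub `<=` cs_set;
  cs_sub_sub : cs_sub `<=` hp_sub X }.

HB.instance Definition _ := gen_eqMixin compactSubpair.
HB.instance Definition _ := gen_choiceMixin compactSubpair.

Definition cs_le (K L : compactSubpair) : bool :=
  `[< cs_set K `<=` cs_set L /\ cs_sub K `<=` cs_sub L >].

Lemma cs_le_refl : reflexive cs_le.
Proof. by move=> K; apply/asboolP; split. Qed.

Lemma cs_le_trans : transitive cs_le.
Proof.
move=> L K M /asboolP[KL KL0] /asboolP[LM LM0]; apply/asboolP.
by split; [exact: subset_trans LM|exact: subset_trans LM0].
Qed.

HB.instance Definition _ := @Order.Le_isPreorder.Build set_display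
  compactSubpair cs_le cs_le_refl cs_le_trans.

Lemma cs_directed (K L : compactSubpair) : exists M, (K <= M)%O /\ (L <= M)%O.
Proof.
have sub1 : cs_sub K `|` cs_sub L `<=` cs_set K `|` cs_set L.
  by apply: setUSS; exact: cs_sub_set.
have sub2 : cs_sub K `|` cs_sub L `<=` hp_sub X.
  by rewrite subUset; split; exact: cs_sub_sub.
exists (CompactSubpair (compactU (@cs_compact K) (@cs_compact L))
  (compactU (@cs_compact_sub K) (@cs_compact_sub L)) sub1 sub2).
by split; apply/asboolP; split=> /= x; [left|left|right|right].
Qed.

Section Object.
Variable K : compactSubpair.

Definition cs_pair : hausdorffPair :=
  @HausdorffPair (set_type (cs_set K)) (set_val @^-1` (cs_sub K))
    (hausdorff_set_type (@hp_hausdorff X)).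

Lemma cs_pair_compact : compact [set: hp_space cs_pair].
Proof.
apply: compact_set_type; rewrite (_ : _ @` _ = cs_set K); first exact: cs_compact.
rewrite eqEsubset; split=> [_ [x _ <-]|x Kx]; first exact: set_valP.
by exists (exist _ x (mem_set Kx)); rewrite // set_valE.
Qed.

Lemma cs_pair_compact_sub : compact (hp_sub cs_pair).
Proof.
apply: compact_set_type; rewrite (_ : _ @` _ = cs_sub K).
  exact: cs_compact_sub.
rewrite eqEsubset; split=> [_ [x xK <-]//|x xK].
have Kx := cs_sub_set xK.
by exists (exist _ x (mem_set Kx)); rewrite //= set_valE.
Qed.

Definition cs_obj : compactPair :=
  CompactPair cs_pair_compact cs_pair_compact_sub.

End Object.

Section Inclusion.
Variables (K L : compactSubpair) (KL : (K <= L)%O).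

Lemma cs_incl_subproof (x : set_type (cs_set K)) : set_val x \in cs_set L.
Proof. by have /asboolP[KL1 _] := KL; apply/mem_set/KL1; exact: set_valP. Qed.

Definition cs_incl_fun (x : cs_pair K) : cs_pair L :=
  @exist X (fun y => y \in cs_set L) (set_val x) (cs_incl_subproof x).

Lemma cs_incl_continuous : continuous cs_incl_fun.
Proof. by apply: continuous_comp_initial; exact: set_val_continuous. Qed.

Lemma cs_incl_sub x :
  hp_sub (cs_pair K) x -> hp_sub (cs_pair L) (cs_incl_fun x).
Proof. by have /asboolP[_] := KL; exact. Qed.

Definition cs_incl : pairMap (cs_obj K) (cs_obj L) :=
  PairMap cs_incl_continuous cs_incl_sub.

End Inclusion.

Variable R : realType.

Definition compactSystem : directSystem (HCpt2 R).
Proof.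
refine (@DirectSystem (HCpt2 R) _ compactSubpair cs_directed cs_obj
  (fun K L KL => hclass R (cs_incl KL)) _ _).
- move=> K KK; congr hclass; apply: pairMapP => x.
  by apply: val_inj.
- move=> K L M KL LM KM; rewrite [LHS]hclass_compE; congr hclass.
  by apply: pairMapP => x; apply: val_inj.
Defined.

End CompactSubpairs.

Definition same_CHshape (R : realType) (X Y : hausdorffPair) : Prop :=
  exists (F : dsMorphism (compactSystem X R) (compactSystem Y R))
         (G : dsMorphism (compactSystem Y R) (compactSystem X R)),
    dm_equiv (dm_comp G F) (dm_id (compactSystem X R)) /\
    dm_equiv (dm_comp F G) (dm_id (compactSystem Y R)).

Record chainComplex := ChainComplex {
  cc_obj :> nat -> zmodType;
  cc_d : forall n, {additive cc_obj n.+1 -> cc_obj n};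
  cc_dd : forall n (x : cc_obj n.+2), cc_d n (cc_d n.+1 x) = 0 }.
Arguments cc_d : clear implicits.
Arguments cc_dd : clear implicits.

Section Homology.
Variable C : chainComplex.

(* There is no differential out of degree 0: every 0-chain is a cycle. *)
Definition cyclep n : {pred C n} :=
  match n return {pred C n} with
  | 0 => predT
  | n'.+1 => [pred x | cc_d C n' x == 0]
  end.

Lemma cyclep_zmod_closed n : zmod_closed (@cyclep n).
Proof.
case: n => [|n]; first by split.
split=> [|x y]; rewrite !inE ?raddf0// => /eqP dx /eqP dy.
by rewrite raddfB /= dx dy subrr.
Qed.

HB.instance Definition _ n :=
  GRing.isZmodClosed.Build (C n) (@cyclep n) (cyclep_zmod_closed n).

Record cycleType n := Cycle { cycle_val : C n; cycle_valP : cycle_val \in @cyclep n }.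

HB.instance Definition _ n := [isSub for @cycle_val n].
HB.instance Definition _ n := [Choice of cycleType n by <:].
HB.instance Definition _ n := [SubChoice_isSubZmodule of cycleType n by <:].

Definition boundaryp n : {pred cycleType n} :=
  [pred z | `[< exists c : C n.+1, cc_d C n c = cycle_val z >]].

Lemma boundaryp_zmod_closed n : zmod_closed (@boundaryp n).
Proof.
split=> [|x y].
  by apply/asboolP; exists 0; rewrite raddf0.
move=> /asboolP[c dc] /asboolP[e de]; apply/asboolP.
by exists (c - e); rewrite raddfB /= dc de.
Qed.

HB.instance Definition _ n :=
  GRing.isZmodClosed.Build (cycleType n) (@boundaryp n) (boundaryp_zmod_closed n).

Definition homology n : zmodType := {quot (@boundaryp n)}.

End Homology.

Section QuotientComplex.
Variables (C : chainComplex) (S : forall n, zmodClosed (C n)).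
Hypothesis dS : forall n x, x \in S n.+1 -> cc_d C n x \in S n.

(* The induced differential, defined on representatives; see quot_dE. *)
Definition quot_d n (x : {quot (S n.+1)}) : {quot (S n)} :=
  \pi_({quot (S n)}) (cc_d C n (repr x)).

Lemma quot_dE n x : quot_d (\pi_({quot (S n.+1)}) x) =
  \pi_({quot (S n)}) (cc_d C n x).
Proof.
apply/eqP; rewrite -idealrBE -(raddfB (cc_d C n)); apply: dS.
by rewrite idealrBE reprK.
Qed.

Lemma quot_d_additive n : zmod_morphism (@quot_d n).
Proof.
move=> x y; rewrite -[x]reprK -[y]reprK -(raddfB \pi_({quot (S n.+1)})) !quot_dE.
by rewrite (raddfB (cc_d C n)) (raddfB \pi_({quot (S n)})).
Qed.

HB.instance Definition _ n :=
  GRing.isZmodMorphism.Build _ _ (@quot_d n) (@quot_d_additive n).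

Lemma quot_dd n x : quot_d (quot_d (x : {quot (S n.+2)})) = 0.
Proof. by rewrite -[x]reprK !quot_dE cc_dd raddf0. Qed.

Definition quotComplex : chainComplex :=
  @ChainComplex (fun n => {quot (S n)}) (fun n => @quot_d n) quot_dd.

End QuotientComplex.

Section LinearExtension.
Variables (K : choiceType) (G V : zmodType) (h : K -> G -> V).
Hypothesis h_additive : forall k, zmod_morphism (h k).

Definition malg_lift (c : malg K G) : V := \sum_(k <- msupp c) h k (mcoeff k c).

Let h0 k : h k 0 = 0.
Proof. by rewrite -[0 in LHS](subrr 0) h_additive subrr. Qed.

Lemma malg_liftEw (c : malg K G) (D : {fset K}) :
  (msupp c `<=` D)%fset -> malg_lift c = \sum_(k <- D) h k (mcoeff k c).
Proof.
move=> cD; rewrite /malg_lift; apply: big_fset_incl => // k _ kc.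
by rewrite mcoeff_outdom// h0.
Qed.

Lemma malg_lift_additive : zmod_morphism malg_lift.
Proof.
move=> c e; set D := (msupp c `|` msupp e)%fset.
rewrite (@malg_liftEw (c - e) D); last exact: msuppB_le.
rewrite (@malg_liftEw c D); last exact: fsubsetUl.
rewrite (@malg_liftEw e D); last exact: fsubsetUr.
by rewrite -sumrB; apply: eq_bigr => k _; rewrite mcoeffB h_additive.
Qed.

Lemma malg_liftU k x : malg_lift (mkmalgU k x) = h k x.
Proof.
rewrite (@malg_liftEw _ [fset k]%fset); last exact: msuppU_le.
by rewrite big_seq_fset1 mcoeffUU.
Qed.

End LinearExtension.

Section Singular.
Variable R : realType.

Definition simplex n : set 'rV[R]_n.+1 :=
  [set x | (forall i, 0 <= x 0 i) /\ \sum_i x 0 i = 1].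
Arguments simplex : clear implicits.

Definition stdSimplex n : topologicalType := set_type (simplex n).

(* A map of vertices f induces the affine map of simplices e_i |-> e_(f i). *)
Section SimplexMap.
Variables (m n : nat) (f : 'I_m.+1 -> 'I_n.+1).

Definition simplex_row (x : 'rV[R]_m.+1) : 'rV[R]_n.+1 :=
  \row_j \sum_(i | f i == j) x 0 i.

Lemma simplex_row_subproof (x : stdSimplex m) :
  simplex_row (set_val x) \in simplex n.
Proof.
have [x0 x1] : simplex m (set_val x) := set_valP x.
apply/mem_set; split=> [j|].
  by rewrite mxE; apply: sumr_ge0 => i _; exact: x0.
under eq_bigr do rewrite mxE.
by rewrite -[RHS]x1 [RHS](partition_big f xpredT).
Qed.

Definition simplex_map (x : stdSimplex m) : stdSimplex n :=
  @exist _ (fun y => y \in simplex n) _ (simplex_row_subproof x).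

Lemma simplex_row_continuous : continuous simplex_row.
Proof.
move=> x A [/= P Px PA]; rewrite nbhs_simpl /=.
have H j : \forall y \near x, P 0 j (simplex_row y 0 j).
  have : continuous (fun y : 'rV[R]_m.+1 => \sum_(i | f i == j) y 0 i).
    apply: continuous_big; first exact: add_continuous.
    by move=> i _; exact: coord_continuous.
  move=> /(_ x) cj; have := Px 0 j; rewrite mxE => /cj; rewrite nbhs_simpl /=.
  by apply: filterS => y; rewrite /= mxE.
have HF := filter_forall _ H.
change (nbhs x (simplex_row @^-1` A)).
have sub : [set y | forall j, P 0 j (simplex_row y 0 j)] `<=` simplex_row @^-1` A.
  by move=> y Hy; apply: PA => i j; rewrite ord1.
exact: filterS sub (HF (nbhs_filter x)).
Qed.

Lemma simplex_map_continuous : continuous simplex_map.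
Proof.
apply: continuous_comp_initial.
apply: (comp_continuous simplex_row_continuous); exact: set_val_continuous.
Qed.

HB.instance Definition _ :=
  @isContinuous.Build (stdSimplex m) (stdSimplex n) simplex_map
    simplex_map_continuous.

End SimplexMap.

Definition coface n (i : 'I_n.+2) : stdSimplex n -> stdSimplex n.+1 :=
  simplex_map (lift i).

HB.instance Definition _ n i := Continuous.on (@coface n i).

Lemma simplex_map_comp m n p (g : 'I_n.+1 -> 'I_p.+1) (f : 'I_m.+1 -> 'I_n.+1) :
  simplex_map g \o simplex_map f = simplex_map (g \o f).
Proof.
apply/funext => x; apply: val_inj; apply/rowP => k; rewrite /= !mxE.
under eq_bigr do rewrite mxE.
rewrite [RHS](partition_big f (fun j => g j == k))//=.
apply: eq_bigr => j /eqP gj; apply: eq_bigl => i.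
by case: eqP => [->|]; rewrite ?gj ?eqxx ?andbF.
Qed.

Lemma alternating_sum0 (V : zmodType) n (F : 'I_n.+3 -> 'I_n.+2 -> V) :
  (forall i p j q, lift i j = p -> lift p q = i -> F i j = F p q) ->
  \sum_i (\sum_j F i j *~ (-1) ^+ j) *~ (-1) ^+ i = 0.
Proof.
move=> FE.
under eq_bigr do rewrite mulrz_suml.
rewrite pair_bigA /= (bigID (fun ij : ('I_n.+3 * 'I_n.+2)%type => (ij.1 <= ij.2)%N)) /=.
pose h (ij : 'I_n.+3 * 'I_n.+2) : 'I_n.+3 * 'I_n.+2 :=
  (lift ij.1 ij.2, inord (if (ij.1 <= ij.2)%N then (ij.1 : nat) else ij.1.-1)).
have h2 ij : h ij = (lift ij.1 ij.2, (h ij).2) by [].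
have hq (ij : 'I_n.+3 * 'I_n.+2) : ((h ij).2 : nat) =
    (if (ij.1 <= ij.2)%N then (ij.1 : nat) else ij.1.-1).
  rewrite /h /= inordK//; case: ij => -[i ilt] [j jlt] /=; case: ifP; lia.
have hlift ij : lift (h ij).1 (h ij).2 = ij.1.
  apply: val_inj; rewrite /= /bump hq /= /bump; case: ij => i j /=; case: ifP; lia.
have hK : involutive h.
  move=> ij; rewrite [LHS]h2 hlift; case: ij hlift hq => i j hlift hq.
  congr pair; apply: ord_inj; rewrite !hq /= /bump.
  by case: (leqP i j) => ij /=; case: ifP => h3 /=; lia.
rewrite [X in _ + X](reindex_inj (inv_inj hK)) /=.
rewrite [X in _ + X](eq_bigl (fun ij : ('I_n.+3 * 'I_n.+2)%type => (ij.1 <= ij.2)%N)); last first.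
  move=> [i j] /=; rewrite /bump; have := hq (i, j); rewrite /= => ->.
  by apply/idP/idP; case: ifP; lia.
rewrite -big_split big1//= => -[i j] /= ij.
rewrite -(FE i (lift i j) j _ erefl (hlift (i, j))) -!mulrzA -!exprD -mulrzDr.
suff -> : (-1) ^+ (j + i) + (-1) ^+ ((h (i, j)).2 + lift i j) = 0 :> int.
  by rewrite mulr0z.
rewrite hq /= ij /bump ij addnC add1n addnS exprS.
by ring.
Qed.

Section Chains.
Variables (X : topologicalType) (G : zmodType).

Definition singularSimplex n := continuousType (stdSimplex n) X.

HB.instance Definition _ n := Choice.on (singularSimplex n).

Definition face n (s : singularSimplex n.+1) (i : 'I_n.+2) :
  singularSimplex n := s \o coface i.

(* C_n(X; G): functions of finite support from the singular simplices to G,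
   i.e. formal sums of terms g s, written mkmalgU s g. *)
Definition chain n : zmodType := malg (singularSimplex n) G.

Definition simplex_boundary n (s : singularSimplex n.+1) (g : G) : chain n :=
  \sum_(i < n.+2) mkmalgU (face s i) g *~ (-1) ^+ i.

Lemma simplex_boundary_additive n (s : singularSimplex n.+1) :
  zmod_morphism (simplex_boundary s).
Proof.
move=> g h; rewrite /simplex_boundary -sumrB; apply: eq_bigr => i _.
by rewrite monalgUB mulrzBl.
Qed.

Definition chain_boundary n : chain n.+1 -> chain n :=
  malg_lift (@simplex_boundary n).

HB.instance Definition _ n :=
  GRing.isZmodMorphism.Build _ _ (@chain_boundary n)
    (malg_lift_additive (@simplex_boundary_additive n)).

Lemma face_face n (s : singularSimplex n.+2) (i p : 'I_n.+3) (j q : 'I_n.+2) :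
  lift i j = p -> lift p q = i -> face (face s i) j = face (face s p) q.
Proof.
move=> ijp pqi; apply/continuousEP => x /=; congr (s _).
have := simplex_map_comp (lift i) (lift j) => /(congr1 (fun h => h x)) /= E.
have := simplex_map_comp (lift p) (lift q) => /(congr1 (fun h => h x)) /= E'.
rewrite /coface E E'; congr (simplex_map _ _).
apply/funext => k; apply: val_inj => /=.
have /(congr1 val) /= := ijp; have /(congr1 val) /= := pqi.
by rewrite /bump; lia.
Qed.

Lemma chain_boundary_boundary n (c : chain n.+2) :
  chain_boundary (chain_boundary c) = 0.
Proof.
have -> : chain_boundary c =
  \sum_(s <- msupp c) simplex_boundary s (mcoeff s c) by [].
rewrite raddf_sum big1 // => s _; move: (mcoeff s c) => g.
rewrite {1}/simplex_boundary raddf_sum /=.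
under eq_bigr => i _.
  rewrite raddfMz /= {1}/chain_boundary.
  rewrite (malg_liftU (@simplex_boundary_additive n)).
  over.
apply: alternating_sum0 => i p j q ijp pqi.
by rewrite (face_face s ijp pqi).
Qed.

Definition singularComplex : chainComplex :=
  @ChainComplex chain (fun n => @chain_boundary n) chain_boundary_boundary.

(* The image of C_n(A; G) in C_n(X; G): a simplex of A is a simplex of X with
   image in A. *)
Definition subchain (A : set X) n : {pred chain n} :=
  [pred c | `[< forall s : singularSimplex n,
                  s \in msupp c -> forall x, A (s x) >]].
Arguments subchain : clear implicits.

Lemma subchain_zmod_closed A n : zmod_closed (subchain A n).
Proof.
split=> [|c e]; first by apply/asboolP => s; rewrite msupp0 in_fset0.
move=> /asboolP cA /asboolP eA; apply/asboolP => s.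
by move=> /(fsubsetP (msuppB_le _ _)); rewrite in_fsetU => /orP[/cA|/eA].
Qed.

HB.instance Definition _ A n :=
  GRing.isZmodClosed.Build (chain n) (subchain A n) (subchain_zmod_closed A n).

Lemma chain_boundary_subchain A n (c : chain n.+1) :
  c \in subchain A n.+1 -> chain_boundary c \in subchain A n.
Proof.
move=> /asboolP cA; rewrite /chain_boundary /malg_lift big_seq_cond.
apply: rpred_sum => s; rewrite andbT => sc.
apply: rpred_sum => i _; apply: rpredMz; apply/asboolP => t.
by move=> /(fsubsetP msuppU_le); rewrite in_fset1 => /eqP -> x; exact: cA.
Qed.

(* C_*(X; G) / C_*(A; G). *)
Definition relativeComplex (A : set X) : chainComplex :=
  @quotComplex singularComplex (fun n => subchain A n : zmodClosed _)
    (@chain_boundary_subchain A).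

End Chains.

Definition relativeHomology (n : nat) (P : hausdorffPair) (G : zmodType) :
  zmodType := homology (relativeComplex G (hp_sub P)) n.

End Singular.

(* Main.v *)
Require Import Defs.
From mathcomp Require Import all_boot all_algebra all_classical all_reals.
From HB Require Import structures.
From mathcomp Require Import order generic_quotient ring_quotient finmap.
From mathcomp Require Import topology normedtype zify.
From mathcomp Require Import -(notations) monalg.

Set Implicit Arguments.
Unset Strict Implicit.
Unset Printing Implicit Defensive.

(** Singular chains have compact supports, so H_n(X, X0; G) is the direct limit
    of the groups H_n(K, K0; G) over the compact subpairs of (X, X0), and the
    CH-shape remembers the direct system whose limit this is.

    Surjectivity of the limit (to_colimit_surj): a relative cycle c is a finite
    sum of simplices, so it lives in the compact pair made of the union of the
    images of the simplices of c and of its boundary.  Injectivity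
    (to_colimit_eq0): if a class of (K, K0) dies in (X, X0), the finitely many
    simplices witnessing this lie in a larger compact pair, where the class is
    already zero.

    The morphisms in the systems are only homotopy classes, so relative
    homology has to be homotopy invariant (induced_homotopic); this is shown
    with the prism operator, whose boundary formula (prism_boundary0 and
    prism_boundaryS) is the combinatorial heart of the argument (prism_sum).
    Relative homology is then a functor on homotopy classes of pairs, and a
    morphism F of direct systems acts on the limits by sending the class coming
    from z in H_n(K, K0; G) to the class of F_K z (shape_map).  Equivalent
    morphisms act equally because F_K z and F'_K z agree at some later stage;
    thus a shape equivalence gives mutually inverse maps. *)

Import Order.TTheory GRing.Theory Num.Theory.
Import numFieldNormedType.Exports.
Import Quotient.

Local Open Scope classical_set_scope.
Local Open Scope ring_scope.
Local Open Scope quotient_scope.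

(** * Relative cycles and their classes *)

Section RelativeClasses.
Variables (C : chainComplex) (S : forall n, zmodClosed (C n)).
Hypothesis dS : forall n x, x \in S n.+1 -> cc_d C n x \in S n.

Local Notation Q := (quotComplex dS).

(** Preimage in C of the cycles of C / S: chains whose boundary lies in S. *)
Definition relcycle n : {pred C n} :=
  [pred c | (\pi_({quot (S n)}) c : Q n) \in @cyclep Q n].

Lemma pi_quot0 n (x : C n) : (\pi_({quot (S n)}) x == 0) = (x \in S n).
Proof. by rewrite -[X in _ == X](raddf0 \pi_({quot (S n)})) -idealrBE subr0. Qed.

Lemma cc_d_pi n (c : C n.+1) :
  cc_d Q n (\pi_({quot (S n.+1)}) c) = \pi_({quot (S n)}) (cc_d C n c).
Proof. exact: quot_dE. Qed.

Lemma relcycle0E (c : C 0) : c \in @relcycle 0.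
Proof. by []. Qed.

Lemma relcycleSE n (c : C n.+1) : (c \in @relcycle n.+1) = (cc_d C n c \in S n).
Proof. by rewrite -pi_quot0 -(quot_dE dS). Qed.

Lemma relcycleB n (c e : C n) :
  c \in @relcycle n -> e \in @relcycle n -> c - e \in @relcycle n.
Proof.
rewrite !inE => cc ec; rewrite (raddfB \pi_({quot (S n)})).
exact: (rpredB (cc : _ \in @cyclep Q n) ec).
Qed.

(** Writing a class as a function of a chain, without a proof that it is a
    relative cycle, keeps rewriting simple; the default value 0 is taken on the
    other chains. *)
Definition relclass n (c : C n) : homology Q n :=
  \pi_({quot (@boundaryp Q n)}) (insubd 0 (\pi_({quot (S n)}) c : Q n)).

Lemma relclassB n (c e : C n) : c \in @relcycle n -> e \in @relcycle n ->
  relclass (c - e) = relclass c - relclass e.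
Proof.
move=> cc ec; rewrite /relclass -(raddfB \pi_({quot (@boundaryp Q n)})).
have ce := relcycleB cc ec.
congr (\pi _); apply: val_inj; rewrite /= !insubdK//.
by rewrite (raddfB \pi_({quot (S n)})).
Qed.

(** Two nested quotients become one condition on chains: c bounds modulo S. *)
Lemma relclass_eq0 n (c : C n) : c \in @relcycle n ->
  (relclass c = 0) <-> (exists e, c - cc_d C n e \in S n).
Proof.
move=> cc; rewrite /relclass -[X in _ = X](raddf0 \pi_({quot (@boundaryp Q n)})).
split.
  move=> /eqP; rewrite -idealrBE subr0 => /asboolP[e].
  rewrite -[e]reprK cc_d_pi insubdK// => /esym/eqP; rewrite -idealrBE => ce.
  by exists (repr e).
case=> e ce; apply/eqP; rewrite -idealrBE subr0; apply/asboolP.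
exists (\pi_({quot (S n.+1)}) e); rewrite cc_d_pi insubdK//.
by apply/esym/eqP; rewrite -idealrBE.
Qed.

Lemma relclass_surj n (x : homology Q n) :
  exists2 c, c \in @relcycle n & relclass c = x.
Proof.
have cx : \pi_({quot (S n)}) (repr (cycle_val (repr x))) = cycle_val (repr x).
  exact: reprK.
exists (repr (cycle_val (repr x))).
  by rewrite inE cx; exact: cycle_valP.
rewrite /relclass cx -[RHS]reprK; congr (\pi _).
by apply: val_inj; rewrite insubdK //; exact: cycle_valP.
Qed.

End RelativeClasses.

Section InducedMap.
Variables (C D : chainComplex).
Variables (S : forall n, zmodClosed (C n)) (T : forall n, zmodClosed (D n)).
Hypothesis dS : forall n x, x \in S n.+1 -> cc_d C n x \in S n.
Hypothesis dT : forall n x, x \in T n.+1 -> cc_d D n x \in T n.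
Variable f : forall n, {additive C n -> D n}.
Hypothesis fd : forall n x, f n (cc_d C n x) = cc_d D n (f n.+1 x).
Hypothesis fS : forall n x, x \in S n -> f n x \in T n.

Lemma relcycle_map n c : c \in @relcycle _ _ dS n -> f n c \in @relcycle _ _ dT n.
Proof. by case: n c => // n c; rewrite !relcycleSE -fd; exact: fS. Qed.

(** The class of f c, for a chosen relative cycle c in the given class. *)
Definition relhomology_map n (x : homology (quotComplex dS) n) :
    homology (quotComplex dT) n :=
  relclass dT (f n (projT1 (cid2 (relclass_surj x)))).

(** Independence of the chosen cycle: if c - e bounds modulo S then f c - f e
    bounds modulo T, by fd and fS. *)
Lemma relhomology_mapE n c : c \in @relcycle _ _ dS n ->
  relhomology_map (relclass dS c) = relclass dT (f n c).
Proof.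
move=> cc; rewrite /relhomology_map; case: cid2 => e /= ec ece.
apply/eqP; rewrite -subr_eq0 -relclassB ?relcycle_map//; apply/eqP.
have /relclass_eq0 : e - c \in @relcycle _ _ dS n by exact: relcycleB.
rewrite relclassB// ece subrr => -[/(_ erefl)[b eb] _].
rewrite -raddfB; apply/relclass_eq0.
  by apply: relcycle_map; apply: relcycleB.
by exists (f n.+1 b); rewrite -fd -raddfB; exact: fS.
Qed.

Lemma relhomology_map_additive n : zmod_morphism (@relhomology_map n).
Proof.
move=> x y; have [c cc <-] := relclass_surj x; have [e ec <-] := relclass_surj y.
rewrite -relclassB// !relhomology_mapE ?relcycleB// raddfB.
by rewrite relclassB ?relcycle_map.
Qed.

End InducedMap.

(** * Chains under continuous maps and maps of pairs *)

Local Notation chains_in A := (@subchain _ _ _ A _).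

Lemma malg_additive_eq (K : choiceType) (G V : zmodType)
    (f g : {additive malg K G -> V}) :
  (forall k x, f (mkmalgU k x) = g (mkmalgU k x)) -> f =1 g.
Proof.
move=> fg c; rewrite (monalgEw (fsubset_refl (msupp c))) !raddf_sum.
by apply: eq_bigr => k _; exact: fg.
Qed.

Lemma simplex_subchain (R : realType) (X : topologicalType) (G : zmodType)
    (A : set X) n (s : singularSimplex R X n) (g : G) :
  (forall x, A (s x)) -> mkmalgU s g \in chains_in A.
Proof.
move=> sA; apply/asboolP => t /(fsubsetP msuppU_le); rewrite in_fset1.
by move=> /eqP ->.
Qed.

(** The common reason why pushforward and prism preserve subcomplexes: it is
    enough that each simplex lying in A is sent into T. *)
Lemma malg_lift_subchain (R : realType) (X : topologicalType) (G V : zmodType)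
    (A : set X) (T : zmodClosed V) n (h : singularSimplex R X n -> G -> V)
    (c : chain R X G n) :
  (forall (s : singularSimplex R X n) g, (forall x, A (s x)) -> h s g \in T) ->
  c \in chains_in A -> malg_lift h c \in T.
Proof.
move=> hT /asboolP cA; rewrite /malg_lift big_seq_cond.
by apply: rpred_sum => s; rewrite andbT => sc; apply: hT; exact: cA.
Qed.

Lemma chain_boundaryU (R : realType) (X : topologicalType) (G : zmodType) n
    (s : singularSimplex R X n.+1) (g : G) :
  chain_boundary (mkmalgU s g) = simplex_boundary s g.
Proof. exact: (malg_liftU (@simplex_boundary_additive R X G n)). Qed.

Section Pushforward.
Variables (R : realType) (G : zmodType) (X Y : topologicalType).
Variable f : continuousType X Y.

Definition push_simplex n (s : singularSimplex R X n) : singularSimplex R Y n :=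
  f \o s.

Definition push n : chain R X G n -> chain R Y G n :=
  malg_lift (fun s g => mkmalgU (push_simplex s) g).

Lemma push_subproof n (s : singularSimplex R X n) :
  zmod_morphism (fun g : G => mkmalgU (push_simplex s) g : chain R Y G n).
Proof. exact: raddfB. Qed.

HB.instance Definition _ n :=
  GRing.isZmodMorphism.Build _ _ (@push n) (malg_lift_additive (@push_subproof n)).

Lemma pushU n (s : singularSimplex R X n) g :
  push (mkmalgU s g) = mkmalgU (push_simplex s) g.
Proof. exact: (malg_liftU (@push_subproof n)). Qed.

Lemma push_boundary n (c : chain R X G n.+1) :
  push (chain_boundary c) = chain_boundary (push c).
Proof.
apply: (@malg_additive_eq _ _ _ (@push n \o @chain_boundary R X G n)
  (@chain_boundary R Y G n \o @push n.+1)) => s g /=.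
rewrite pushU !chain_boundaryU raddf_sum; apply: eq_bigr => i _.
rewrite raddfMz [X in X *~ _]pushU.
by have -> : push_simplex (face s i) = face (push_simplex s) i
  by exact/continuousEP.
Qed.

Lemma push_subchain n (A : set X) (B : set Y) (c : chain R X G n) :
  (forall x, A x -> B (f x)) -> c \in chains_in A -> push c \in chains_in B.
Proof.
move=> fAB; apply: malg_lift_subchain => s g sA.
by apply: simplex_subchain => x; exact/fAB/sA.
Qed.

Hypothesis finj : injective f.

Lemma push_simplex_inj n : injective (@push_simplex n).
Proof.
by move=> s t /continuousEP st; apply/continuousEP => x; exact/finj/st.
Qed.

(** Over an injective map distinct simplices stay distinct, so no coefficients
    are merged and supports can be read off from the pushforward. *)
Lemma mcoeff_push n (c : chain R X G n) (s : singularSimplex R X n) :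
  mcoeff (push_simplex s) (push c) = mcoeff s c.
Proof.
apply: (@malg_additive_eq _ _ _ (mcoeff (push_simplex s) \o @push n)
  (mcoeff s)) => t g /=.
by rewrite pushU !mcoeffU (inj_eq (@push_simplex_inj n)).
Qed.

Lemma subchain_push n (B : set Y) (c : chain R X G n) :
  push c \in chains_in B -> c \in chains_in (f @^-1` B).
Proof.
move=> /asboolP cB; apply/asboolP => s; rewrite -mcoeff_neq0 -mcoeff_push.
by rewrite mcoeff_neq0 => /cB.
Qed.

End Pushforward.

Lemma push_comp (R : realType) (G : zmodType) (X Y Z : topologicalType)
    (h : continuousType Y Z) (f : continuousType X Y) n (c : chain R X G n) :
  push h (push f c) = push (h \o f) c.
Proof.
apply: (@malg_additive_eq _ _ _ (@push R G Y Z h n \o @push R G X Y f n)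
  (@push R G X Z (h \o f) n)) => s g /=.
by rewrite !pushU; congr mkmalgU; exact/continuousEP.
Qed.

Lemma eq_push (R : realType) (G : zmodType) (X Y : topologicalType)
    (f g : continuousType X Y) n (c : chain R X G n) :
  f =1 g -> push f c = push g c.
Proof. by move=> /continuousEP ->. Qed.

HB.instance Definition _ P Q (f : pairMap P Q) :=
  @isContinuous.Build P Q f (pm_continuous f).

Section PairMaps.
Variables (R : realType) (G : zmodType).

Local Notation H n P := (relativeHomology R n P G).

(** The chains of the subspace, typed over the singular complex so that the
    algebra of relative classes applies up to conversion. *)
Let S (P : hausdorffPair) n : zmodClosed (singularComplex R P G n) :=
  @subchain R P G (hp_sub P) n.

Let boundary_sub (P : hausdorffPair) n (c : singularComplex R P G n.+1) :
    c \in S P n.+1 -> cc_d (singularComplex R P G) n c \in S P n :=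
  @chain_boundary_subchain R P G (hp_sub P) n c.

Definition paircycle n (P : hausdorffPair) : {pred chain R P G n} :=
  @relcycle (singularComplex R P G) _ (@boundary_sub P) n.
Arguments paircycle : clear implicits.

Definition pairclass n (P : hausdorffPair) (c : chain R P G n) : H n P :=
  @relclass (singularComplex R P G) _ (@boundary_sub P) n c.

Lemma paircycleB n (P : hausdorffPair) (c e : chain R P G n) :
  c \in paircycle n P -> e \in paircycle n P -> c - e \in paircycle n P.
Proof. exact: (@relcycleB (singularComplex R P G) _ (@boundary_sub P)). Qed.

Lemma paircycle0E (P : hausdorffPair) (c : chain R P G 0) : c \in paircycle 0 P.
Proof. exact: (@relcycle0E (singularComplex R P G) _ (@boundary_sub P)). Qed.

Lemma paircycleSE n (P : hausdorffPair) (c : chain R P G n.+1) :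
  (c \in paircycle n.+1 P) = (chain_boundary c \in chains_in (hp_sub P)).
Proof. exact: (@relcycleSE (singularComplex R P G) _ (@boundary_sub P)). Qed.

Lemma pairclassB n (P : hausdorffPair) (c e : chain R P G n) :
  c \in paircycle n P -> e \in paircycle n P ->
  pairclass (c - e) = pairclass c - pairclass e.
Proof. exact: (@relclassB (singularComplex R P G) _ (@boundary_sub P)). Qed.

Lemma pairclass_eq0 n (P : hausdorffPair) (c : chain R P G n) :
  c \in paircycle n P ->
  pairclass c = 0 <-> exists e, c - chain_boundary e \in chains_in (hp_sub P).
Proof. exact: (@relclass_eq0 (singularComplex R P G) _ (@boundary_sub P)). Qed.

Lemma pairclass_surj n (P : hausdorffPair) (x : H n P) :
  exists2 c, c \in paircycle n P & pairclass c = x.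
Proof. exact: (@relclass_surj (singularComplex R P G) _ (@boundary_sub P)). Qed.

Section Induced.
Variables P Q : hausdorffPair.
Variable f : pairMap P Q.

Let push_f n : {additive singularComplex R P G n -> singularComplex R Q G n} :=
  @push R G P Q f n.

Let push_f_boundary n (c : singularComplex R P G n.+1) :
  push_f n (cc_d (singularComplex R P G) n c) =
  cc_d (singularComplex R Q G) n (push_f n.+1 c).
Proof. exact: push_boundary. Qed.

Let push_f_sub n (c : singularComplex R P G n) :
  c \in chains_in (hp_sub P) -> push_f n c \in chains_in (hp_sub Q).
Proof. by apply: push_subchain; exact: pm_sub. Qed.

Definition induced n : H n P -> H n Q :=
  relhomology_map (@boundary_sub Q) push_f (n := n).

HB.instance Definition _ n :=
  GRing.isZmodMorphism.Build _ _ (@induced n)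
    (relhomology_map_additive (@boundary_sub Q) push_f_boundary push_f_sub
      (n := n)).

Lemma push_paircycle n (c : chain R P G n) :
  c \in paircycle n P -> push f c \in paircycle n Q.
Proof. exact: (relcycle_map (@boundary_sub Q) push_f_boundary push_f_sub). Qed.

Lemma inducedE n (c : chain R P G n) :
  c \in paircycle n P -> induced (pairclass c) = pairclass (push f c).
Proof. exact: (relhomology_mapE (@boundary_sub Q) push_f_boundary push_f_sub). Qed.

End Induced.

Lemma induced_comp n (P Q T : hausdorffPair) (g : pairMap Q T)
    (f : pairMap P Q) (x : H n P) :
  induced (pm_comp g f) x = induced g (induced f x).
Proof.
have [c cc <-] := pairclass_surj x.
rewrite !inducedE// ?push_paircycle// push_comp; congr pairclass.
by apply: eq_push.
Qed.

End PairMaps.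
Arguments paircycle {R G} n P _.

(** * The prism operator *)

(** The cancellation scheme of the prism operator.  A i k is the k-th face of
    the i-th piece of the prism over a simplex, B k i the i-th piece of the
    prism over its k-th face, and U i the i-th horizontal slice.  Faces off the
    diagonals cancel against the prisms over the faces; the two diagonals
    telescope from the top slice U 0 to the bottom slice U n.+1.  With indices
    in nat the identities between faces are linear arithmetic. *)
Section PrismSum.
Variables (V : zmodType) (n : nat) (A B : nat -> nat -> V) (U : nat -> V).
Hypothesis Adiag : forall i, (i <= n)%N -> A i i = U i.
Hypothesis Asub : forall i, (i <= n)%N -> A i i.+1 = U i.+1.
Hypothesis Alow : forall i k, (k <= i < n)%N -> A i.+1 k = B k i.
Hypothesis Ahigh : forall i k, (i < k <= n)%N -> A i k.+1 = B k i.

Lemma prism_sum :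
  \sum_(i < n.+1) (\sum_(k < n.+2) A i k *~ (-1) ^+ k) *~ (-1) ^+ i +
  \sum_(k < n.+1) (\sum_(i < n) B k i *~ (-1) ^+ i) *~ (-1) ^+ k =
  U 0%N - U n.+1.
Proof.
pose e m : int := (-1) ^+ m.
have eS m : e m.+1 = - e m by rewrite /e exprS mulN1r.
have ee i : e (i + i)%N = 1 by rewrite /e addnn -signr_odd odd_double.
have split_row i : (i <= n)%N ->
    \sum_(k < n.+2) A i k *~ e (i + k)%N =
    \sum_(0 <= k < i) A i k *~ e (i + k)%N + (U i - U i.+1) -
    \sum_(i.+1 <= k < n.+1) B k i *~ e (i + k)%N.
  (* Row i crosses the two diagonals at k = i and k = i.+1. *)
  move=> lein; rewrite -(big_mkord xpredT (fun k => A i k *~ e (i + k)%N)).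
  rewrite (@big_cat_nat _ _ _ i)//=; last by rewrite ltnW// ltnS ltnW.
  rewrite -addrA; congr (_ + _).
  rewrite big_ltn ?ltnS ?leqW// big_ltn ?ltnS//.
  rewrite Adiag// Asub// addrA; congr (_ + _ + _).
  - by rewrite ee mulr1z.
  - by rewrite addnS eS mulrNz ee mulr1z.
  rewrite big_add1 /= -sumrN !big_nat; apply: eq_bigr => k /andP[ik kn].
  by rewrite Ahigh ?ik// addnS eS mulrNz.
under eq_bigr => i _.
  rewrite mulrz_suml; under eq_bigr do rewrite -mulrzA -exprD addnC -/(e _).
  rewrite (split_row _ (ltn_ord i)).
  over.
rewrite -(big_mkord xpredT (fun i => \sum_(0 <= k < i) A i k *~ e (i + k)%N +
  (U i - U i.+1) - \sum_(i.+1 <= k < n.+1) B k i *~ e (i + k)%N)).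
rewrite big_split sumrN big_split /= -[\sum_(0 <= i < n.+1) (_ - _)]opprK.
rewrite -sumrN; under [X in - X]eq_bigr do rewrite opprB.
rewrite telescope_sumr// opprB.
rewrite big_nat_recl// big_geq// add0r.
rewrite [X in _ - X + _]big_nat_recr//= [X in _ - (_ + X) + _]big_geq// addr0.
have -> : \sum_(0 <= i < n) \sum_(0 <= k < i.+1) A i.+1 k *~ e (i.+1 + k)%N =
    - \sum_(0 <= i < n) \sum_(0 <= k < i.+1) B k i *~ e (i + k)%N.
  rewrite -sumrN !big_nat; apply: eq_bigr => i /= lin.
  rewrite -sumrN !big_nat; apply: eq_bigr => k /= lki.
  by rewrite Alow; [rewrite addSn eS mulrNz|rewrite -ltnS lki].
have -> : \sum_(k < n.+1) (\sum_(i < n) B k i *~ (-1) ^+ i) *~ (-1) ^+ k =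
    \sum_(0 <= i < n) \sum_(0 <= k < n.+1) B k i *~ e (i + k)%N.
  under eq_bigr do rewrite mulrz_suml.
  rewrite exchange_big big_mkord; apply: eq_bigr => i _.
  rewrite big_mkord; apply: eq_bigr => k _.
  by rewrite -mulrzA -exprD.
have -> : \sum_(0 <= i < n) \sum_(0 <= k < n.+1) B k i *~ e (i + k)%N =
    \sum_(0 <= i < n) \sum_(0 <= k < i.+1) B k i *~ e (i + k)%N +
    \sum_(0 <= i < n) \sum_(i.+1 <= k < n.+1) B k i *~ e (i + k)%N.
  rewrite -big_split /= !big_nat; apply: eq_bigr => i /= lin.
  by rewrite -big_cat_nat// ltnS ltnW.
by rewrite addrACA addNr addr0 addrAC addNr add0r.
Qed.

End PrismSum.

Section Height.
Variable R : realType.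

(** The affine function on the simplex which is 1 on the vertices selected by
    chi and 0 on the others, with values in the unit interval. *)
Definition height n (chi : pred 'I_n.+1) (x : stdSimplex R n) : unitInterval R :=
  clamp (\sum_(j | chi j) (set_val x : 'rV[R]_n.+1) 0 j).

Lemma height_continuous n (chi : pred 'I_n.+1) : continuous (height chi).
Proof.
apply: (comp_continuous (@clamp_continuous R)).
apply: (comp_continuous (g := fun y : 'rV[R]_n.+1 => \sum_(j | chi j) y 0 j)).
  apply: continuous_big; first exact: add_continuous.
  by move=> i _; exact: coord_continuous.
exact: set_val_continuous.
Qed.

(** Both sides are affine and agree on the vertices. *)
Lemma height_simplex_map m n (f : 'I_m.+1 -> 'I_n.+1) (chi : pred 'I_n.+1) x :
  height chi (simplex_map f x) = height (chi \o f) x.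
Proof.
congr clamp; rewrite [RHS](partition_big f chi)//=.
apply: eq_bigr => j chij; rewrite mxE.
by apply: eq_bigl => i; case: eqP => [->|]; rewrite ?chij ?andbF.
Qed.

Lemma height0 n x : height (@pred0 'I_n.+1) x = I0 R.
Proof. by rewrite /height big_pred0. Qed.

Lemma height1 n x : height (@predT 'I_n.+1) x = I1 R.
Proof. by congr clamp; have [_] : simplex (set_val x) := set_valP x. Qed.

Lemma simplex_map_id n (x : stdSimplex R n) : simplex_map id x = x.
Proof.
by apply: val_inj; apply/rowP => j; rewrite mxE big_pred1_eq.
Qed.

End Height.

Section Prism.
Variables (R : realType) (G : zmodType) (X Y : topologicalType).
Variable H : continuousType (X * unitInterval R)%type Y.

(** H composed with s x id and with the affine map from the m-simplex to the
    prism that sends vertex j to (a j, chi j).  The vertex map a is given on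
    nat, so that faces of pieces are computed by composing with bump. *)
Definition prism_fun n m (a : nat -> nat) (chi : pred nat)
    (s : singularSimplex R X n) (x : stdSimplex R m) : Y :=
  H (s (simplex_map (fun j => inord (a j)) x), height (fun j => chi j) x).

Lemma prism_fun_continuous n m a chi s : continuous (@prism_fun n m a chi s).
Proof.
apply: comp_continuous; first exact: cts_fun.
apply: pair_continuous; last exact: height_continuous.
by apply: comp_continuous; [exact: cts_fun|exact: simplex_map_continuous].
Qed.

HB.instance Definition _ n m a chi s :=
  @isContinuous.Build _ _ (@prism_fun n m a chi s)
    (@prism_fun_continuous n m a chi s).

Definition prism_simplex n m a chi s : singularSimplex R Y m :=
  @prism_fun n m a chi s.

Lemma eq_prism_simplex n m a a' (chi chi' : pred nat) (s : singularSimplex R X n) :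
  (forall j, (j <= m)%N -> a j = a' j) ->
  (forall j, (j <= m)%N -> chi j = chi' j) ->
  prism_simplex m a chi s = prism_simplex m a' chi' s.
Proof.
move=> aa' cc'; apply/continuousEP => x; rewrite /= /prism_fun.
have -> : (fun j : 'I_m.+1 => inord (a j) : 'I_n.+1) = (fun j => inord (a' j)).
  by apply/funext => j; rewrite (aa' _ (ltn_ord j)).
by have -> : (fun j : 'I_m.+1 => chi j) = (fun j => chi' j)
  by apply/funext => j; rewrite (cc' _ (ltn_ord j)).
Qed.

Lemma face_prism n m a chi (s : singularSimplex R X n) (k : 'I_m.+2) :
  face (prism_simplex m.+1 a chi s) k =
  prism_simplex m (a \o bump k) (chi \o bump k) s.
Proof.
apply/continuousEP => x; rewrite /= /prism_fun height_simplex_map.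
congr (H (s _, _)).
exact: (congr1 (fun h => h x) (simplex_map_comp R _ (lift k))).
Qed.

Lemma prism_face n m a chi (s : singularSimplex R X n.+1) (k : 'I_n.+2) :
  (forall j, (j <= m)%N -> (a j <= n)%N) ->
  prism_simplex m a chi (face s k) = prism_simplex m (bump k \o a) chi s.
Proof.
move=> an; apply/continuousEP => x; rewrite /= /prism_fun; congr (H (s _, _)).
have /(congr1 (fun h => h x)) /= := simplex_map_comp R (lift k)
  (fun j : 'I_m.+1 => inord (a j) : 'I_n.+1).
rewrite /coface => ->; congr (simplex_map _ x); apply/funext => j; apply: ord_inj.
have jm : (j <= m)%N by rewrite -ltnS.
have := an j jm => ajn.
rewrite /= !inordK ?ltnS// /bump.
by case: (k <= a j)%N; rewrite ?add1n ?add0n// ltnW.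
Qed.

(** The i-th piece [v_0, .., v_i, w_i, .., w_n] of the prism, where the v_j are
    the bottom vertices and the w_j the top ones: vertex i is repeated, and the
    vertices after position i are on top. *)
Definition prism_cell n i (s : singularSimplex R X n) : singularSimplex R Y n.+1 :=
  prism_simplex n.+1 (unbump i) (ltn i) s.

Definition simplex_prism n (s : singularSimplex R X n) (g : G) : chain R Y G n.+1 :=
  \sum_(i < n.+1) mkmalgU (prism_cell i s) g *~ (-1) ^+ i.

Lemma prism_subproof n (s : singularSimplex R X n) :
  zmod_morphism (simplex_prism s).
Proof.
move=> g h; rewrite /simplex_prism -sumrB; apply: eq_bigr => i _.
by rewrite monalgUB mulrzBl.
Qed.

Definition prism n : chain R X G n -> chain R Y G n.+1 :=
  malg_lift (@simplex_prism n).

HB.instance Definition _ n :=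
  GRing.isZmodMorphism.Build _ _ (@prism n)
    (malg_lift_additive (@prism_subproof n)).

Lemma prismU n (s : singularSimplex R X n) g :
  prism (mkmalgU s g) = simplex_prism s g.
Proof. exact: (malg_liftU (@prism_subproof n)). Qed.

Lemma prism_subchain n (A : set X) (B : set Y) (c : chain R X G n) :
  (forall x t, A x -> B (H (x, t))) -> c \in chains_in A -> prism c \in chains_in B.
Proof.
move=> HAB; apply: malg_lift_subchain => s g sA.
apply: rpred_sum => i _; apply: rpredMz; apply: simplex_subchain => x.
exact/HAB/sA.
Qed.

Variables f g : continuousType X Y.
Hypothesis H0 : forall x, H (x, I0 R) = f x.
Hypothesis H1 : forall x, H (x, I1 R) = g x.

(** The simplex [v_0, .., v_(i-1), w_i, .., w_n] inside the prism,
    common to the pieces i - 1 and i; it is the top for i = 0 and the bottom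
    for i = n.+1. *)
Definition slice n i (s : singularSimplex R X n) : singularSimplex R Y n :=
  prism_simplex n id (leq i) s.

Lemma slice_top n (s : singularSimplex R X n) : slice 0 s = push_simplex g s.
Proof.
apply/continuousEP => x; rewrite /= /prism_fun -H1.
rewrite (_ : (fun j : 'I_n.+1 => inord j) = id); last first.
  by apply/funext => j; rewrite inord_val.
by rewrite simplex_map_id -(height1 x).
Qed.

Lemma slice_bottom n (s : singularSimplex R X n) : slice n.+1 s = push_simplex f s.
Proof.
apply/continuousEP => x; rewrite /= /prism_fun -H0.
rewrite (_ : (fun j : 'I_n.+1 => inord j) = id); last first.
  by apply/funext => j; rewrite inord_val.
rewrite simplex_map_id -(height0 x); congr (H (_, height _ _)).
by apply/funext => j; rewrite leqNgt ltn_ord.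
Qed.

(** B stands for the prism over the boundary of s.  It is left abstract because
    that prism exists only in positive degree, whereas in degree 0 the second
    sum has no nonzero terms whatever B is. *)
Lemma boundary_simplex_prism n (s : singularSimplex R X n) (u : G)
    (B : nat -> nat -> chain R Y G n) :
  (forall k i, (k <= n)%N -> (i < n)%N ->
    B k i = mkmalgU (prism_simplex n (bump k \o unbump i) (ltn i) s) u) ->
  chain_boundary (simplex_prism s u) +
    \sum_(k < n.+1) (\sum_(i < n) B k i *~ (-1) ^+ i) *~ (-1) ^+ k =
  mkmalgU (push_simplex g s) u - mkmalgU (push_simplex f s) u.
Proof.
move=> BE; pose U i : chain R Y G n := mkmalgU (slice i s) u.
pose A i k : chain R Y G n :=
  mkmalgU (prism_simplex n (unbump i \o bump k) (ltn i \o bump k) s) u.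
have -> : chain_boundary (simplex_prism s u) =
    \sum_(i < n.+1) (\sum_(k < n.+2) A i k *~ (-1) ^+ k) *~ (-1) ^+ i.
  have cellE i : simplex_boundary (prism_cell i s) u =
      \sum_(k < n.+2) A i k *~ (-1) ^+ k.
    by apply: eq_bigr => k _; rewrite [face _ _]face_prism.
  rewrite raddf_sum; apply: eq_bigr => i _.
  by rewrite raddfMz [X in X *~ _]chain_boundaryU cellE.
rewrite -slice_top -slice_bottom; apply: (@prism_sum _ n A B U).
- move=> i lein; congr mkmalgU; apply: eq_prism_simplex => j _ /=.
    by rewrite bumpK.
  by rewrite /bump; lia.
- move=> i lein; congr mkmalgU; apply: eq_prism_simplex => j _ /=.
    by rewrite /bump /unbump; lia.
  by rewrite /bump; lia.
- move=> i k /andP[leki ltin]; rewrite BE//; last exact: leq_trans (ltnW ltin).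
  congr mkmalgU; apply: eq_prism_simplex => j _ /=.
    by rewrite /bump /unbump; lia.
  by rewrite /bump; lia.
- move=> i k /andP[ltik lekn]; rewrite BE//; last exact: leq_trans lekn.
  congr mkmalgU; apply: eq_prism_simplex => j _ /=.
    by rewrite /bump /unbump; lia.
  by rewrite /bump; lia.
Qed.

Lemma prism_boundary0 (c : chain R X G 0) :
  chain_boundary (prism c) = push g c - push f c.
Proof.
apply: (@malg_additive_eq _ _ _ (@chain_boundary R Y G 0 \o @prism 0)
  (@push R G X Y g 0 \- @push R G X Y f 0)) => s u /=.
rewrite prismU !pushU -(@boundary_simplex_prism _ _ _ (fun _ _ => 0))//.
by rewrite big1 ?addr0// => k _; rewrite big_ord0 mul0rz.
Qed.

(** The prism operator is a chain homotopy from f to g. *)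
Lemma prism_boundaryS n (c : chain R X G n.+1) :
  chain_boundary (prism c) + prism (chain_boundary c) = push g c - push f c.
Proof.
apply: (@malg_additive_eq _ _ _
  ((@chain_boundary R Y G n.+1 \o @prism n.+1) \+
   (@prism n \o @chain_boundary R X G n))
  (@push R G X Y g n.+1 \- @push R G X Y f n.+1)) => s u /=.
rewrite prismU !pushU -(@boundary_simplex_prism _ _ _ (fun k i =>
  mkmalgU (prism_simplex n.+1 (bump k \o unbump i) (ltn i) s) u))//.
rewrite chain_boundaryU; congr (_ + _); rewrite raddf_sum; apply: eq_bigr => k _.
rewrite raddfMz [X in X *~ _]prismU.
have -> : simplex_prism (face s k) u = \sum_(i < n.+1)
    mkmalgU (prism_simplex n.+1 (bump k \o unbump i) (ltn i) s) u *~ (-1) ^+ i.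
  apply: eq_bigr => i _; rewrite /prism_cell prism_face// => j lejn.
  by rewrite /unbump; have := ltn_ord i; lia.
by [].
Qed.

End Prism.

(** * Homotopy invariance *)

Section HomotopyInvariance.
Variables (R : realType) (G : zmodType) (n : nat).

Local Notation H P := (relativeHomology R n P G).

(** g c - f c differs from a boundary by the prism over the boundary of c.
    That boundary lies in the subspace of P and the homotopy is one of pairs, so
    the prism over it lies in the subspace of Q. *)
Lemma induced_homotopic (P Q : hausdorffPair) (f g : pairMap P Q) :
  homotopic R f g -> @induced R G P Q f n =1 @induced R G P Q g n.
Proof.
move=> /asboolP[h [ch h0 h1 hsub]] x; have [c cc <-] := pairclass_surj x.
rewrite !inducedE//; apply/esym/eqP; rewrite -subr_eq0.
rewrite -pairclassB ?push_paircycle//; apply/eqP/pairclass_eq0.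
  by apply: paircycleB; exact: push_paircycle.
exists (prism (mkcts ch) c); case: n c cc {x} => [|m] c cc.
  by rewrite (prism_boundary0 (f := f) (g := g))// subrr rpred0.
rewrite -(prism_boundaryS (f := f) (g := g) (H := mkcts ch))// addrC addKr.
by apply: prism_subchain; [exact: hsub|rewrite -paircycleSE].
Qed.

Definition class_map (P Q : hausdorffPair) (h : homotopyClass R P Q) : H P -> H Q :=
  @induced R G P Q (repr h) n.

HB.instance Definition _ P Q (h : homotopyClass R P Q) :=
  GRing.Additive.on (@class_map P Q h).

(** Homotopy invariance makes the choice of a representative immaterial. *)
Lemma class_mapE (P Q : hausdorffPair) (f : pairMap P Q) (x : H P) :
  class_map (hclass R f) x = induced f x.
Proof. by apply: induced_homotopic; apply/hclassP; rewrite /hclass reprK. Qed.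

Lemma class_map_comp (P Q T : hausdorffPair) (h : homotopyClass R Q T)
    (k : homotopyClass R P Q) (x : H P) :
  class_map (hclass_comp h k) x = class_map h (class_map k x).
Proof. by rewrite /hclass_comp class_mapE induced_comp. Qed.

End HomotopyInvariance.

(** * Compact supports *)

Section CompactSupports.
Variable R : realType.

(** A closed subset of a cube. *)
Lemma simplex_compact n : compact (@simplex R n).
Proof.
pose box := [set v : 'rV[R]_n.+1 | forall i, v ord0 i \in `[0 : R, 1]].
have cbox : compact box.
  apply: (@rV_compact _ _ (fun=> `[0 : R, 1]%classic)) => _.
  exact: segment_compact.
apply: subclosed_compact cbox _; last first.
  move=> x [x0 x1] i; rewrite in_itv /= x0 -x1 (bigD1 i)//= lerDl.
  by apply: sumr_ge0 => j _; exact: x0.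
rewrite (_ : @simplex R n = (\bigcap_i [set x : 'rV[R]_n.+1 | 0 <= x 0 i]) `&`
    [set x : 'rV[R]_n.+1 | \sum_i x 0 i = 1]); last first.
  by rewrite eqEsubset; split=> x [x0 x1]; split=> // i; [move=> _|]; exact: x0.
apply: closedI.
  apply: closed_bigI => i _.
  apply: (@preimage_closed _ _ (fun x : 'rV[R]_n.+1 => x 0 i) [set r | 0 <= r]).
    by move=> x _; exact: coord_continuous.
  exact: closed_ge.
apply: (@preimage_closed _ _ (fun x : 'rV[R]_n.+1 => \sum_i x 0 i) [set r | r = 1]).
  move=> x _; move: x; apply: continuous_big; first exact: add_continuous.
  by move=> i _; exact: coord_continuous.
exact: closed_eq.
Qed.

Lemma stdSimplex_compact n : compact [set: stdSimplex R n].
Proof.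
apply: compact_set_type; rewrite (_ : _ @` _ = @simplex R n).
  exact: simplex_compact.
rewrite eqEsubset; split=> [_ [x _ <-]|x sx]; first exact: set_valP.
by exists (exist _ x (mem_set sx)); rewrite //= set_valE.
Qed.

Variable G : zmodType.

Section Carrier.
Variable X : topologicalType.

Definition carrier n (c : chain R X G n) : set X :=
  \big[setU/set0]_(s <- msupp c) range (s : singularSimplex R X n).

Lemma carrier_compact n (c : chain R X G n) : compact (carrier c).
Proof.
apply: bigsetU_compact => s _; apply: continuous_compact.
  by apply: continuous_subspaceT; exact: cts_fun.
exact: stdSimplex_compact.
Qed.

Lemma subchainP n (A : set X) (c : chain R X G n) :
  c \in chains_in A <-> carrier c `<=` A.
Proof.
split=> [/asboolP cA|cA].
  rewrite /carrier big_seq_cond; elim/big_ind: _ => // [B D BA DA|s].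
    by rewrite subUset.
  by rewrite andbT => /cA sA _ [x _ <-].
apply/asboolP => s sc x; apply: cA; rewrite /carrier.
by rewrite (big_fsetD1 s)//=; left; exists x.
Qed.

End Carrier.

Section Lift.
Variables (X : topologicalType) (K : set X).

Lemma lift_simplex n (s : singularSimplex R X n) : (forall x, K (s x)) ->
  exists t : singularSimplex R (set_type K) n,
    push_simplex (mkcts (@set_val_continuous X K)) t = s.
Proof.
move=> sK.
pose t x : set_type K := exist (fun y => y \in K) (s x) (mem_set (sK x)).
have ct : continuous t by apply: continuous_comp_initial; exact: cts_fun.
by exists (mkcts ct); apply/continuousEP.
Qed.

(** The simplices of c corestrict to K, which has the subspace topology. *)
Lemma lift_chain n (c : chain R X G n) : c \in chains_in K ->
  exists c' : chain R (set_type K) G n,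
    push (mkcts (@set_val_continuous X K)) c' = c.
Proof.
move=> /asboolP cK; rewrite (monalgEw (fsubset_refl (msupp c))) big_seq_cond.
elim/big_ind: _ => [|_ _ [a <-] [b <-]|s]; first by exists 0; rewrite raddf0.
  by exists (a + b); rewrite raddfD.
rewrite andbT => /cK /lift_simplex[t <-]; move: (mcoeff _ c) => u.
by exists (mkmalgU t u); rewrite pushU.
Qed.

End Lift.

Section Colimit.
Variables (X : hausdorffPair) (n : nat).

Definition cs_val (K : compactSubpair X) : pairMap (cs_obj K) X :=
  @PairMap (cs_obj K) X (@set_val X (cs_set K)) (@set_val_continuous X (cs_set K))
    (fun x Kx => @cs_sub_sub X K _ Kx).

Lemma cs_val_inj (K : compactSubpair X) : injective (cs_val K).
Proof. exact: val_inj. Qed.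

Lemma lift_subpair m (K : compactSubpair X) (c : chain R X G m) :
  carrier c `<=` cs_set K -> exists c', push (cs_val K) c' = c.
Proof.
move=> /subchainP /lift_chain[c' <-]; exists c'; exact: eq_push.
Qed.

Lemma lift_subchain m (K : compactSubpair X) (c : chain R (cs_obj K) G m) :
  carrier (push (cs_val K) c) `<=` cs_sub K ->
  c \in chains_in (hp_sub (cs_obj K)).
Proof. by move=> /subchainP /subchain_push; apply; exact: cs_val_inj. Qed.

Lemma cs_val_incl (K L : compactSubpair X) (KL : (K <= L)%O) :
  pm_comp (cs_val L) (cs_incl KL) = cs_val K.
Proof. exact: pairMapP. Qed.

Local Notation H P := (relativeHomology R n P G).

Definition to_colimit (K : compactSubpair X) : H (cs_obj K) -> H X :=
  @induced R G (cs_obj K) X (cs_val K) n.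

HB.instance Definition _ K := GRing.Additive.on (@to_colimit K).

Lemma to_colimit_incl (K L : compactSubpair X) (KL : (K <= L)%O)
    (z : H (cs_obj K)) :
  to_colimit (induced (cs_incl KL) z) = to_colimit z.
Proof. by rewrite /to_colimit -induced_comp cs_val_incl. Qed.

(** Besides the chain itself, its boundary must be captured, and by the
    subspace part B of the compact pair.  In degree 0 every chain is a relative
    cycle and B is empty. *)
Lemma paircycle_support (c : chain R X G n) : c \in paircycle n X ->
  exists B : set X, [/\ compact B, B `<=` hp_sub X &
    forall (K : compactSubpair X) c', push (cs_val K) c' = c -> B `<=` cs_sub K ->
      c' \in paircycle n (cs_obj K)].
Proof.
case: n c => [|m] c cc.
  exists set0; split=> [|//|K c' _ _]; [exact: compact0|exact: paircycle0E].
exists (carrier (chain_boundary c)); split.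
- exact: carrier_compact.
- by apply/subchainP; rewrite -paircycleSE.
- move=> K c' <- BK; rewrite paircycleSE; apply: lift_subchain.
  by rewrite push_boundary.
Qed.

Lemma to_colimit_surj (x : H X) : exists K (z : H (cs_obj K)), to_colimit z = x.
Proof.
have [c cc <-] := pairclass_surj x; have [B [cB BX BE]] := paircycle_support cc.
pose K := CompactSubpair (compactU (@carrier_compact _ _ c) cB) cB
  (@subsetUr _ (carrier c) B) BX.
have [c' c'E] : exists c', push (cs_val K) c' = c.
  by apply: lift_subpair; exact: subsetUl.
exists K, (pairclass c'); rewrite /to_colimit inducedE ?c'E//.
exact: BE c'E _.
Qed.

(** If the image c of a cycle of K equals the boundary of e up to a chain b of
    X0, enlarge K by the carriers of b and e and K0 by that of b. *)
Lemma to_colimit_eq0 (K : compactSubpair X) (z : H (cs_obj K)) :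
  to_colimit z = 0 -> exists L (KL : (K <= L)%O), induced (cs_incl KL) z = 0.
Proof.
have [c cc <-] := pairclass_surj z; rewrite /to_colimit inducedE//.
move=> /pairclass_eq0 [|e]; first exact: push_paircycle.
set b := _ - _ => bX.
have sub1 : cs_sub K `|` carrier b `<=` cs_set K `|` (carrier b `|` carrier e).
  by move=> x [/cs_sub_set|bx]; [left|right; left].
have sub2 : cs_sub K `|` carrier b `<=` hp_sub X.
  by rewrite subUset; split; [exact: cs_sub_sub|exact/subchainP].
pose L := CompactSubpair
  (compactU (@cs_compact _ K)
    (compactU (@carrier_compact _ _ b) (@carrier_compact _ _ e)))
  (compactU (@cs_compact_sub _ K) (@carrier_compact _ _ b)) sub1 sub2.
have KL : (K <= L)%O by apply/asboolP; split=> x; left.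
have [e' e'E] : exists e', push (cs_val L) e' = e.
  by apply: lift_subpair => x ex; right; right.
exists L, KL; rewrite inducedE//; apply/pairclass_eq0; first exact: push_paircycle.
exists e'; apply: lift_subchain => x.
rewrite raddfB [X in carrier (_ - X)]push_boundary e'E.
rewrite [X in carrier (X - _)]push_comp.
rewrite (@eq_push _ _ _ _ _ (cs_val K))// => bx.
by right.
Qed.

End Colimit.

End CompactSupports.

(** * Maps induced by morphisms of the direct systems *)

Section ShapeMap.
Variables (R : realType) (G : zmodType) (n : nat).

Local Notation H P := (relativeHomology R n P G).
Local Notation CS X := (compactSystem X R).

(** The kernel condition at a common upper bound M of K and K', applied to the
    difference of the images of z and z'. *)
Lemma to_colimit_eq (X : hausdorffPair) (K K' : compactSubpair X)
    (z : H (cs_obj K)) (z' : H (cs_obj K')) :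
  to_colimit z = to_colimit z' ->
  exists L (KL : (K <= L)%O) (K'L : (K' <= L)%O),
    induced (cs_incl KL) z = induced (cs_incl K'L) z'.
Proof.
move=> zz'; have [M [KM K'M]] := cs_directed K K'.
have [|L [ML]] := @to_colimit_eq0 R G X n M
  (induced (cs_incl KM) z - induced (cs_incl K'M) z').
  by rewrite raddfB /= !to_colimit_incl zz' subrr.
rewrite raddfB /= -!induced_comp => /eqP; rewrite subr_eq0 => /eqP E.
exists L, (le_trans KM ML), (le_trans K'M ML).
have inclE N (NM : (N <= M)%O) :
    pm_comp (cs_incl ML) (cs_incl NM) = cs_incl (le_trans NM ML).
  by apply: pairMapP => x; exact: val_inj.
by rewrite -!inclE.
Qed.

(** Directedness of the compact subpairs; it makes additivity a statement about
    a single stage. *)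
Lemma common_support (X : hausdorffPair) (x y : H X) :
  exists (K : compactSubpair X) (z z' : H (cs_obj K)),
    to_colimit z = x /\ to_colimit z' = y.
Proof.
have [K [z <-]] := to_colimit_surj x; have [K' [z' <-]] := to_colimit_surj y.
have [L [KL K'L]] := cs_directed K K'.
exists L, (induced (cs_incl KL) z), (induced (cs_incl K'L) z').
by rewrite !to_colimit_incl.
Qed.

Section Map.
Variables (X Y : hausdorffPair) (F : dsMorphism (CS X) (CS Y)).

Definition stage_map (K : compactSubpair X) : H (cs_obj K) -> H Y :=
  @to_colimit R G Y n (dm_index F K) \o
    @class_map R G n (cs_obj K) (cs_obj (dm_index F K : compactSubpair Y))
      (dm_map F K).

HB.instance Definition _ K := GRing.Additive.on (@stage_map K).

Lemma stage_map_incl (K L : compactSubpair X) (KL : (K <= L)%O) (z : H (cs_obj K)) :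
  stage_map (induced (cs_incl KL) z) = stage_map z.
Proof.
have := congr1 (fun h => @class_map R G n (cs_obj K)
  (cs_obj (dm_index F L : compactSubpair Y)) h z) (dm_natural F KL).
rewrite /= !class_map_comp !class_mapE => E.
by rewrite /stage_map /= -E to_colimit_incl.
Qed.

(** Through a chosen stage K and a chosen preimage of x there. *)
Definition shape_map (x : H X) : H Y :=
  let Kz := cid (to_colimit_surj x) in stage_map (projT1 (cid (projT2 Kz))).

(** Independence of the choices: two preimages of x agree at a later stage, and
    the stage maps are compatible by naturality of F. *)
Lemma shape_mapE (K : compactSubpair X) (z : H (cs_obj K)) :
  shape_map (to_colimit z) = stage_map z.
Proof.
rewrite /shape_map; case: cid => K' /= ?; case: cid => z' /= /to_colimit_eq.
by case=> L [K'L [KL E]]; rewrite -(stage_map_incl K'L) E stage_map_incl.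
Qed.

Lemma shape_map_additive : zmod_morphism shape_map.
Proof.
move=> x y; have [K [z [z' [<- <-]]]] := common_support x y.
by rewrite -raddfB /= !shape_mapE raddfB.
Qed.

HB.instance Definition _ :=
  GRing.isZmodMorphism.Build _ _ shape_map shape_map_additive.

End Map.

(** At a stage L beyond K the composite of F and F' agrees with the inclusion
    of K into L, so it returns the class it started from. *)
Lemma shape_map_retract (X Y : hausdorffPair)
    (F : dsMorphism (CS X) (CS Y)) (F' : dsMorphism (CS Y) (CS X)) :
  dm_equiv (dm_comp F' F) (dm_id (CS X)) -> cancel (shape_map F) (shape_map F').
Proof.
move=> F'F x; have [K [z <-]] := to_colimit_surj x; rewrite !shape_mapE.
have [L [GL [KL]]] := F'F K; rewrite compm1.
move=> /(congr1 (fun h => @class_map R G n (cs_obj K)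
  (cs_obj (L : compactSubpair X)) h z)).
rewrite /= !class_map_comp !class_mapE => /(congr1 (@to_colimit R G X n L)).
by rewrite !to_colimit_incl.
Qed.

End ShapeMap.

Theorem theorem5p3 (R : realType) (X Y : hausdorffPair) (G : zmodType)
    (hXY : same_CHshape R X Y) (n : nat) :
  exists phi : {additive relativeHomology R n X G -> relativeHomology R n Y G},
    bijective phi.
Proof.
have [F [F' [F'F FF']]] := hXY.
exists (@shape_map R G n X Y F); exists (@shape_map R G n Y X F').
- exact: shape_map_retract F'F.
- exact: shape_map_retract FF'.
Qed.
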